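(* Let $\mathcal{V}$ be a variety of algebras. Let $\mathcal{W}$ be a congruence-proper variety of algebras with a finite similarity type. Let $(X,\mathbf{X})$ be an $\aleph_0$-lifter of a poset $P$. Let $\vec A=(A_p,f_{p,q}\mid p\le q\text{ in }P)$ be a $P$-indexed diagram in $\mathcal{V}$ such that $\operatorname{Con}_{\mathrm c}A_p$ is finite for each $p\in P^{=}$. Let $B\in\mathcal{W}$ be such that $\operatorname{Con}_{\mathrm c}B\cong\operatorname{Con}_{\mathrm c}(\mathbf{F}(X)\otimes\vec A)$. Then there exists a lifting $\vec B=(B_p,g_{p,q}\mid p\le q\text{ in }P)$ of $\operatorname{Con}_{\mathrm c}\circ\vec A$ in $\mathcal{W}$ such that $B_p$ is a quotient of $B$ for each $p\in P$.
   Context: For an algebra $A$, $\operatorname{Con}_{\mathrm c}A$ is the $(\vee,0)$-semilattice (join-semilattice with least element $0$) of compact (finitely generated) congruences of $A$; it is a functor: for $f\colon A\to B$, $(\operatorname{Con}_{\mathrm c}f)(\theta)$ is the congruence of $B$ generated by $\{(f(x),f(y))\mid(x,y)\in\theta\}$. A lifting in $\mathcal W$ of a $P$-indexed diagram $\vec S$ of $(\vee,0)$-semilattices is a $P$-indexed diagram $\vec B$ in $\mathcal W$ with $\operatorname{Con}_{\mathrm c}\circ\vec B\cong\vec S$ (natural isomorphism). A variety is congruence-proper if each of its members with a finite congruence lattice is finite. $P^{=}$ is the set of non-maximal elements of $P$. **Norm-coverings and lifters.** A finite subset $V$ of a poset $U$ is a kernel if for every $u\in U$ there is a largest $v\in V$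 with $v\le u$. $U$ is supported if every finite subset of $U$ is contained in a kernel. A norm-covering of $P$ is a pair $(U,\partial)$ with $U$ a supported poset and $\partial\colon U\to P$ isotone. An ideal (nonempty, upward directed, lower subset) $\boldsymbol u$ of $U$ is sharp if $\{\partial u\mid u\in\boldsymbol u\}$ has a largest element, denoted $\partial\boldsymbol u$. $\operatorname{Id_s}U$ is the set of sharp ideals ordered by inclusion. An $\aleph_0$-lifter of $P$ is a pair $(U,\mathbf U)$ where $U$ is a norm-covering of $P$ and $\mathbf U\subseteq\operatorname{Id_s}U$ such that: (1) the set $\mathbf U^{=}=\{\boldsymbol u\in\mathbf U\mid\partial\boldsymbol u\text{ not maximal in }P\}$ satisfies that $\{\boldsymbol v\in\mathbf U\mid \boldsymbol v\subseteq\boldsymbol u\}$ is finite for each $\boldsymbol u\in\mathbf U^{=}$; (2) for every map $S\colon\mathbf U^{=}\to[U]^{<\omega}$ (finite subsets of $U$) there is an isotone $\sigma\colon P\to\mathbf U$ with $\partial\sigma(p)=p$ for all $p\in P$ and $S(\sigma(p))\cap\sigma(q)\subseteq\sigma(p)$ for all $p<q$ in $P$. **Condensate.** For a norm-covering $(X,\partial)$ of $P$ and a $P$-indexed diagram $\vec A=(A_p,f_{p,q})$ in a variety, $\mathbf F(X)\otimes\vec A$ is the directed colimit, over all kernels $V$ of $X$ ordered by inclusion, of the finite products $\prod_{v\in V}A_{\partial v}$, with transition map for kernels $V\subseteq W$ sending $(a_v)_{v\in V}$ to $(f_{\partial(w^V),\partial w}(a_{w^V}))_{w\in W}$, where $w^V$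 is the largest element of $V$ below $w$. *)

(* Defs.v *)
From HB Require Import structures.
From mathcomp Require Import all_boot all_order.
From mathcomp Require Import boolp classical_sets functions cardinality.

Set Implicit Arguments.
Unset Strict Implicit.
Unset Printing Implicit Defensive.
Import Order.TTheory.
Local Open Scope order_scope.
Local Open Scope classical_set_scope.

Record signature : Type := Signature {
  operation : Type;
  arity : operation -> nat }.

(* Algebras have a nonempty carrier.  The convention matters: with empty
   members in the diagram, condensates would collapse to the empty algebra. *)
Record algebra (S : signature) : Type := Algebra {
  carrier :> Type;
  interp : forall o : operation S, ('I_(arity o) -> carrier) -> carrier;
  carrier_inhabited : inhabited carrier }.
Arguments interp {S a} o x : rename.

Record hom (S : signature) (A B : algebra S) : Type := Hom {
  hom_fun :> A -> B;
  hom_interp : forall (o : operation S) (x : 'I_(arity o) -> A),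
    hom_fun (interp o x) = interp o (hom_fun \o x) }.

Definition isomorphic (S : signature) (A B : algebra S) : Prop :=
  exists h : hom A B, bijective h.

Inductive term (S : signature) : Type :=
| TVar of nat
| TApp (o : operation S) of ('I_(arity o) -> term S).
Arguments TVar {S} _.

Fixpoint eval (S : signature) (A : algebra S) (env : nat -> A) (t : term S)
    : A :=
  match t with
  | TVar n => env n
  | TApp o ts => interp o (fun i => eval env (ts i))
  end.

Record variety : Type := Variety {
  sig_of : signature;
  identities : set (term sig_of * term sig_of) }.

Definition in_variety (V : variety) (A : algebra (sig_of V)) : Prop :=
  forall e, identities e -> forall env : nat -> A, eval env e.1 = eval env e.2.

Definition finite_similarity_type (V : variety) : Prop :=
  finite_set [set: operation (sig_of V)].

Section QuotientType.
Variables (T : Type) (R : set (T * T)).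

Definition quot_type : Type :=
  {C : set T | exists x, C = [set y | R (x, y)]}.

Definition quot_pi (x : T) : quot_type :=
  exist _ [set y | R (x, y)] (ex_intro _ x erefl).

Definition quot_repr (C : quot_type) : T := projT1 (cid (svalP C)).

Lemma quot_reprK : cancel quot_repr quot_pi.
Proof.
move=> [C HC]; rewrite /quot_repr /=; case: cid => x /= Cx.
exact/esym/eq_exist.
Qed.

Definition equivalence : Prop :=
  [/\ forall x, R (x, x),
      forall x y, R (x, y) -> R (y, x)
    & forall x y z, R (x, y) -> R (y, z) -> R (x, z)].

Lemma eq_quot_pi : equivalence ->
  forall x y, quot_pi x = quot_pi y <-> R (x, y).
Proof.
move=> [Rr Rs Rt] x y; split.
  move=> /(congr1 sval)/= /(congr1 (fun C : set T => C y)) /= ->.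
  exact: Rr.
move=> xy; apply/eq_exist/seteqP; split=> z /= h.
  exact: Rt (Rs _ _ xy) h.
exact: Rt xy h.
Qed.

Lemma quot_repr_pi : equivalence -> forall x, R (x, quot_repr (quot_pi x)).
Proof. by move=> Req x; apply/(eq_quot_pi Req); rewrite quot_reprK. Qed.

End QuotientType.

Definition is_congruence (S : signature) (A : algebra S) : set (set (A * A)) :=
  [set R | equivalence R /\
    forall (o : operation S) (x y : 'I_(arity o) -> A),
      (forall i, R (x i, y i)) -> R (interp o x, interp o y)].

Definition quot_alg (S : signature) (A : algebra S) (R : set (A * A))
    : algebra S :=
  @Algebra S (quot_type R)
    (fun o x => quot_pi R (interp o (@quot_repr A R \o x)))
    (let: inhabits a := carrier_inhabited A in inhabits (quot_pi R a)).

Lemma quot_pi_interp (S : signature) (A : algebra S) (R : set (A * A)) :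
  is_congruence R -> forall o (x : 'I_(arity o) -> A),
  quot_pi R (interp o x) = @interp S (quot_alg R) o (quot_pi R \o x).
Proof.
move=> [Req Rc] o x; apply/(eq_quot_pi Req)/Rc => i.
exact: quot_repr_pi.
Qed.

Definition is_quotient_of (S : signature) (C A : algebra S) : Prop :=
  exists2 R : set (A * A), is_congruence R & isomorphic C (quot_alg R).

Definition congruence_proper (W : variety) : Prop :=
  forall A : algebra (sig_of W), in_variety A ->
    finite_set (@is_congruence _ A) -> finite_set [set: A].

Section Conc.
Variables (S : signature) (A : algebra S).

Definition cg (R : set (A * A)) : set (A * A) := smallest (@is_congruence S A) R.

Lemma cg_congruence R : is_congruence (cg R).
Proof.
split; first split.
- by move=> x M /= [[[r _ _] _] _]; exact: r.
- move=> x y h M /= HM; have [[[_ s _] _] _] := HM; exact: s (h _ HM).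
- move=> x y z h k M /= HM; have [[[_ _ t] _] _] := HM.
  exact: t (h _ HM) (k _ HM).
- move=> o x y h M /= HM; have [[_ c] _] := HM; by apply: c => i; exact: h HM.
Qed.

Lemma sub_cg R : R `<=` cg R. Proof. exact: sub_smallest. Qed.

Lemma cg_sub R M : is_congruence M -> R `<=` M -> cg R `<=` M.
Proof. by move=> cM RM x; apply; split. Qed.

Lemma cg_subP R M : is_congruence M -> (cg R `<=` M) <-> (R `<=` M).
Proof.
split=> [h|]; [exact: subset_trans (@sub_cg R) h | exact: cg_sub].
Qed.

Record conc : Type := Conc {
  conc_rel :> set (A * A);
  conc_fingen : exists2 R, finite_set R & conc_rel = cg R }.

HB.instance Definition _ := gen_eqMixin conc.
HB.instance Definition _ := gen_choiceMixin conc.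

Lemma conc_inj (x y : conc) : conc_rel x = conc_rel y -> x = y.
Proof.
by case: x y => [x hx] [y hy] /= e; subst y; congr Conc; exact: Prop_irrelevance.
Qed.

Lemma conc_congruence (x : conc) : is_congruence x.
Proof. by have [R _ ->] := conc_fingen x; exact: cg_congruence. Qed.

Definition conc_le (x y : conc) : bool := `[< x `<=` y >].

Lemma conc_le_refl : reflexive conc_le.
Proof. by move=> x; apply/asboolP. Qed.

Lemma conc_le_anti : antisymmetric conc_le.
Proof.
by move=> x y /andP[/asboolP xy /asboolP yx]; apply/conc_inj/seteqP.
Qed.

Lemma conc_le_trans : transitive conc_le.
Proof.
move=> y x z /asboolP xy /asboolP yz; apply/asboolP; exact: subset_trans yz.
Qed.

Lemma conc_join_fingen (x y : conc) :
  exists2 R, finite_set R & cg (x `|` y) = cg R.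
Proof.
have [Rx fx ex] := conc_fingen x; have [Ry fy ey] := conc_fingen y.
exists (Rx `|` Ry); first by rewrite finite_setU.
apply/seteqP; split; apply: cg_sub; try exact: cg_congruence.
  rewrite ex ey => z [h|h]; apply: cg_sub h; try exact: cg_congruence.
    by move=> t ?; apply: sub_cg; left.
  by move=> t ?; apply: sub_cg; right.
move=> z [h|h]; apply: sub_cg.
  by left; rewrite ex; exact: sub_cg.
by right; rewrite ey; exact: sub_cg.
Qed.

Definition conc_join (x y : conc) : conc := Conc (conc_join_fingen x y).

Definition conc_bot : conc := Conc (ex_intro2 _ _ set0 (finite_set0 _) erefl).

End Conc.

Fact semilattice_display : Order.disp_t.
Proof. exact: Order.Disp tt tt. Qed.

HB.instance Definition _ (S : signature) (A : algebra S) :=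
  Order.Le_isPOrder.Build semilattice_display (conc A)
    (@conc_le_refl S A) (@conc_le_anti S A) (@conc_le_trans S A).

Lemma conc_leP (S : signature) (A : algebra S) (x y : conc A) :
  reflect (x `<=` y) (x <= y).
Proof. exact: asboolP. Qed.

Lemma conc_leUx (S : signature) (A : algebra S) (x y z : conc A) :
  (conc_join x y <= z) = (x <= z) && (y <= z).
Proof.
apply/conc_leP/andP => [h|[/conc_leP xz /conc_leP yz]].
  by split; apply/conc_leP => t ?; apply: h; apply: sub_cg; [left|right].
by apply: cg_sub; [exact: conc_congruence|move=> t []; [exact: xz|exact: yz]].
Qed.

HB.instance Definition _ (S : signature) (A : algebra S) :=
  Order.POrder_isJoinSemilattice.Build semilattice_display (conc A)
    (@conc_leUx S A).

Lemma conc_le0x (S : signature) (A : algebra S) (x : conc A) :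
  conc_bot A <= x.
Proof. by apply/conc_leP; apply: cg_sub; [exact: conc_congruence|]. Qed.

HB.instance Definition _ (S : signature) (A : algebra S) :=
  Order.hasBottom.Build semilattice_display (conc A) (@conc_le0x S A).

Notation semilattice := (bJoinSemilatticeType semilattice_display).

Definition semilattice_hom (L M : semilattice) (h : L -> M) : Prop :=
  {morph h : x y / (x `|` y)%O} /\ h \bot = \bot.

Definition semilattice_iso (L M : semilattice) (h : L -> M) : Prop :=
  semilattice_hom h /\ bijective h.

Definition semilattice_isomorphic (L M : semilattice) : Prop :=
  exists h : L -> M, semilattice_iso h.

Section ConcMap.
Variables (S : signature) (A B : algebra S) (f : hom A B).

Definition hom_image (R : set (A * A)) : set (B * B) :=
  [set (f z.1, f z.2) | z in R].

Lemma preim_congruence (M : set (B * B)) : is_congruence M ->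
  is_congruence [set z : A * A | M (f z.1, f z.2)].
Proof.
move=> [[r s t] c]; split; first split.
- by move=> x; exact: r.
- by move=> x y; exact: s.
- by move=> x y z; exact: t.
- by move=> o x y h /=; rewrite !hom_interp; exact: c.
Qed.

Lemma hom_image_subP (R : set (A * A)) (M : set (B * B)) :
  (hom_image R `<=` M) <-> (R `<=` [set z : A * A | M (f z.1, f z.2)]).
Proof.
split=> h z; first by move=> Rz; apply: h; exists z.
by case=> t Rt <-; exact: h.
Qed.

Lemma cg_hom_image R : cg (hom_image (cg R)) = cg (hom_image R).
Proof.
apply/seteqP; split; apply: cg_sub; try exact: cg_congruence.
  apply/hom_image_subP; apply: cg_sub; first exact: preim_congruence (cg_congruence _).
  by apply/hom_image_subP; exact: sub_cg.
apply: subset_trans (@sub_cg _ _ _) => _ [t Rt <-].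
by exists t => //; exact: sub_cg.
Qed.

Lemma conc_map_fingen (x : conc A) :
  exists2 R, finite_set R & cg (hom_image x) = cg R.
Proof.
have [R fR ->] := conc_fingen x.
by exists (hom_image R); [exact: finite_image | exact: cg_hom_image].
Qed.

Definition conc_map (x : conc A) : conc B := Conc (conc_map_fingen x).

Lemma conc_map_subP (x : conc A) (y : conc B) :
  (conc_map x <= y) <-> (x `<=` [set z : A * A | conc_rel y (f z.1, f z.2)]).
Proof.
split=> [/conc_leP/= | h].
  by move/(cg_subP _ (conc_congruence y))/hom_image_subP.
by apply/conc_leP/(cg_subP _ (conc_congruence y))/hom_image_subP.
Qed.

Lemma conc_map_hom : semilattice_hom conc_map.
Proof.
split.
  move=> x y; apply/le_anti/andP; split.
    apply/conc_map_subP; apply: cg_sub; first exact: preim_congruence (conc_congruence _).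
    by move=> z [h|h]; [have /conc_map_subP := leUl (conc_map x) (conc_map y)
      | have /conc_map_subP := leUr (conc_map y) (conc_map x)]; exact.
  rewrite leUx; apply/andP; split; apply/conc_map_subP => z h;
    apply: sub_cg; exists z => //; apply: sub_cg; by [left|right].
apply/le_anti; rewrite le0x andbT; apply/conc_map_subP; apply: cg_sub => //.
exact: preim_congruence (conc_congruence _).
Qed.

End ConcMap.

Record diagram (d : Order.disp_t) (P : porderType d) (S : signature) : Type :=
  Diagram {
    diag_ob :> P -> algebra S;
    diag_map : forall p q, p <= q -> hom (diag_ob p) (diag_ob q);
    diag_id : forall p (pp : p <= p), diag_map pp =1 id;
    diag_comp : forall p q r (pq : p <= q) (qr : q <= r) (pr : p <= r),
      diag_map pr =1 diag_map qr \o diag_map pq }.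

Lemma diag_map_comp (d : Order.disp_t) (P : porderType d) (S : signature)
    (A : diagram P S) p q r (pq : p <= q) (qr : q <= r) (pr : p <= r) (x : A p) :
  diag_map A qr (diag_map A pq x) = diag_map A pr x.
Proof. by rewrite (diag_comp pq qr pr). Qed.

Definition diagram_in (d : Order.disp_t) (P : porderType d) (V : variety)
    (A : diagram P (sig_of V)) : Prop :=
  forall p, in_variety (A p).

Record sl_diagram (d : Order.disp_t) (P : porderType d) : Type := SlDiagram {
  sl_ob :> P -> semilattice;
  sl_map : forall p q, p <= q -> sl_ob p -> sl_ob q;
  sl_hom : forall p q (pq : p <= q), semilattice_hom (sl_map pq);
  sl_id : forall p (pp : p <= p), sl_map pp =1 id;
  sl_comp : forall p q r (pq : p <= q) (qr : q <= r) (pr : p <= r),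
    sl_map pr =1 sl_map qr \o sl_map pq }.

Definition sl_diagram_iso (d : Order.disp_t) (P : porderType d)
    (L M : sl_diagram P) : Prop :=
  exists2 h : forall p, L p -> M p,
    forall p, semilattice_iso (h p)
  & forall p q (pq : p <= q), h q \o sl_map pq =1 sl_map pq \o h p.

Section ConcDiagram.
Variables (d : Order.disp_t) (P : porderType d) (S : signature).
Variable A : diagram P S.

Lemma conc_diag_id p (pp : p <= p) : conc_map (diag_map A pp) =1 id.
Proof.
move=> x; apply/le_anti/andP; split.
  by apply/conc_map_subP => -[a b] /=; rewrite !diag_id.
by apply/conc_leP => -[a b] xab; apply: sub_cg; exists (a, b); rewrite ?diag_id.
Qed.

Lemma conc_diag_comp p q r (pq : p <= q) (qr : q <= r) (pr : p <= r) :
  conc_map (diag_map A pr) =1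
  conc_map (diag_map A qr) \o conc_map (diag_map A pq).
Proof.
move=> x; apply/le_anti/andP; split; apply/conc_map_subP.
  move=> [a b] xab /=; rewrite !(diag_comp pq qr) /=.
  apply: sub_cg; exists (diag_map A pq a, diag_map A pq b) => //.
  by apply: sub_cg; exists (a, b).
apply: cg_sub; first exact: preim_congruence (conc_congruence _).
move=> _ [[a b] xab <-] /=; apply: sub_cg; exists (a, b) => //=.
by rewrite !(diag_comp pq qr).
Qed.

Definition conc_diagram : sl_diagram P :=
  @SlDiagram d P (fun p => conc (A p)) (fun p q pq => conc_map (diag_map A pq))
    (fun p q pq => conc_map_hom (diag_map A pq)) conc_diag_id conc_diag_comp.

End ConcDiagram.

Definition is_lifting (d : Order.disp_t) (P : porderType d) (W : variety)
    (L : sl_diagram P) (B : diagram P (sig_of W)) : Prop :=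
  diagram_in B /\ sl_diagram_iso (conc_diagram B) L.

Definition prod_alg (S : signature) (I : Type) (F : I -> algebra S)
    : algebra S :=
  @Algebra S (forall i, F i) (fun o x i => interp o (fun j => x j i))
    (inhabits (fun i => inhabited_witness (carrier_inhabited (F i)))).

Definition directed (d : Order.disp_t) (I : porderType d) : Prop :=
  inhabited I /\ forall i j : I, exists2 k, i <= k & j <= k.

Section DirectedColimit.
Variables (d : Order.disp_t) (I : porderType d) (S : signature).
Variables (dirI : directed I) (D : diagram I S).

Definition dc_sum : Type := {i : I & D i}.

Definition dc_rel : set (dc_sum * dc_sum) :=
  [set z | exists k (h1 : tag z.1 <= k) (h2 : tag z.2 <= k),
     diag_map D h1 (tagged z.1) = diag_map D h2 (tagged z.2)].

Lemma directed_ub n (t : 'I_n -> I) : exists k, forall i, t i <= k.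
Proof.
case: dirI => -[i0] dir; elim: n t => [|n IHn] t; first by exists i0 => -[].
have [k hk] := IHn (t \o lift ord0); have [l kl tl] := dir k (t ord0).
exists l => i; case: (unliftP ord0 i) => [j ->|->//].
exact: le_trans (hk j) kl.
Qed.

Definition dc_ub n (t : 'I_n -> I) : I := projT1 (cid (directed_ub t)).

Definition dc_ubP n (t : 'I_n -> I) : forall i, t i <= dc_ub t :=
  projT2 (cid (directed_ub t)).

Definition dc_in (i : I) (a : D i) : quot_type dc_rel :=
  quot_pi dc_rel (existT _ i a).

(* Operations are computed in a stage above chosen representatives of the
   arguments; lemma [dc_in_interp] states that the choices are immaterial. *)
Definition dc_interp (o : operation S) (x : 'I_(arity o) -> quot_type dc_rel)
    : quot_type dc_rel :=
  let r := @quot_repr _ dc_rel \o x in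
  let k_ub := dc_ubP (fun j => tag (r j)) in
  dc_in (interp o (fun j => diag_map D (k_ub j) (tagged (r j)))).

Definition dircolim : algebra S :=
  @Algebra S (quot_type dc_rel) dc_interp
    (let: inhabits i := proj1 dirI in
     inhabits (dc_in (inhabited_witness (carrier_inhabited (D i))))).

Lemma dc_rel_equivalence : equivalence dc_rel.
Proof.
split.
- by move=> [i a]; exists i, (lexx i), (lexx i).
- by move=> [i a] [j b] [k [h1 [h2 e]]]; exists k, h2, h1.
- move=> [i a] [j b] [l c] [k [h1 [h2 /= e]]] [k' [h3 [h4 /= e']]].
  have [m km k'm] := dirI.2 k k'.
  exists m, (le_trans h1 km), (le_trans h4 k'm) => /=.
  rewrite (diag_comp h1 km) (diag_comp h4 k'm) /= e -e'.
  by rewrite !(diag_map_comp _ _ (le_trans h2 km)).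
Qed.

Lemma dc_in_eq i j (a : D i) (b : D j) :
  dc_in a = dc_in b <->
  exists k (h1 : i <= k) (h2 : j <= k), diag_map D h1 a = diag_map D h2 b.
Proof. exact: (eq_quot_pi dc_rel_equivalence). Qed.

Lemma dc_in_map i j (ij : i <= j) (a : D i) : dc_in (diag_map D ij a) = dc_in a.
Proof.
apply/dc_in_eq; exists j, (lexx j), ij.
by rewrite diag_id.
Qed.

Lemma dc_in_surj (x : dircolim) : exists i (a : D i), x = dc_in a.
Proof.
exists (tag (quot_repr x)), (tagged (quot_repr x)).
by rewrite -[LHS]quot_reprK /dc_in; case: (quot_repr x).
Qed.

Lemma dc_in_interp i (o : operation S) (x : 'I_(arity o) -> D i) :
  dc_in (interp o x) = @interp S dircolim o (@dc_in i \o x).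
Proof.
rewrite /= /dc_interp.
set r := (@quot_repr _ dc_rel \o (@dc_in i \o x)).
set k := dc_ub _.
have rP j : exists l (h1 : i <= l) (h2 : tag (r j) <= l),
    diag_map D h1 (x j) = diag_map D h2 (tagged (r j)).
  exact: (quot_repr_pi dc_rel_equivalence (existT _ i (x j))).
pose l j := projT1 (cid (rP j)).
have lP j : exists (h1 : i <= l j) (h2 : tag (r j) <= l j),
    diag_map D h1 (x j) = diag_map D h2 (tagged (r j)).
  exact: projT2 (cid (rP j)).
have [m0 lm0] := directed_ub l.
have [m1 im1 km1] := dirI.2 i k.
have [m m0m m1m] := dirI.2 m0 m1.
have im := le_trans im1 m1m; have km := le_trans km1 m1m.
apply/dc_in_eq; exists m, im, km; rewrite !hom_interp; congr interp.
apply/funext => j /=.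
have [h1 [h2 e]] := lP j; have ljm := le_trans (lm0 j) m0m.
by rewrite (diag_comp h1 ljm im) /= e !(diag_map_comp _ _ (le_trans h2 ljm)).
Qed.

Definition dc_hom (i : I) : hom (D i) dircolim :=
  @Hom S (D i) dircolim (@dc_in i) (@dc_in_interp i).

Lemma dircolim_universal (C : algebra S) (c : forall i, hom (D i) C) :
  (forall i j (ij : i <= j), c j \o diag_map D ij =1 c i) ->
  exists! g : hom dircolim C, forall i, g \o dc_hom i =1 c i.
Proof.
move=> cc.
pose g (x : dircolim) : C := c (tag (quot_repr x)) (tagged (quot_repr x)).
have gin i (a : D i) : g (dc_in a) = c i a.
  rewrite /g.
  have [k [h1 [h2 /= e]]] :=
    quot_repr_pi dc_rel_equivalence (existT _ i a : dc_sum).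
  by rewrite -(cc _ _ h2) /= -e; exact: cc.
have ghom (o : operation S) (x : 'I_(arity o) -> dircolim) :
    g (interp o x) = interp o (g \o x).
  rewrite [interp o x]/(dc_interp x) /dc_interp gin hom_interp; congr interp.
  by apply/funext => j /=; exact: cc.
exists (Hom ghom); split=> [i a|[g' hg'] /= gi]; first exact: gin.
have e : g = g'.
  by apply/funext => x; have [i [a ->]] := dc_in_surj x; rewrite gin -gi.
by subst g'; congr Hom; exact: Prop_irrelevance.
Qed.

End DirectedColimit.

Section Kernels.
Variables (d : Order.disp_t) (X : porderType d).

Definition is_largest (A : set X) (m : X) : Prop := A m /\ ubound A m.

Definition is_kernel (V : set X) : Prop :=
  finite_set V /\ forall u, exists v, is_largest [set w | V w /\ w <= u] v.

Definition supported : Prop :=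
  forall F : set X, finite_set F -> exists2 V, is_kernel V & F `<=` V.

Record kernel : Type := Kernel {
  kernel_set :> set X;
  kernelP : is_kernel kernel_set }.

HB.instance Definition _ := gen_eqMixin kernel.
HB.instance Definition _ := gen_choiceMixin kernel.

Definition kernel_le (V W : kernel) : bool := `[< V `<=` W >].

Lemma kernel_le_refl : reflexive kernel_le.
Proof. by move=> V; apply/asboolP. Qed.

Lemma kernel_le_anti : antisymmetric kernel_le.
Proof.
move=> [V hV] [W hW] /andP[/asboolP/= VW /asboolP/= WV].
have e : V = W by apply/seteqP.
by subst W; congr Kernel; exact: Prop_irrelevance.
Qed.

Lemma kernel_le_trans : transitive kernel_le.
Proof.
move=> W V Z /asboolP VW /asboolP WZ; apply/asboolP; exact: subset_trans WZ.
Qed.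

Lemma kernel_below_ex (V : kernel) (u : X) :
  {v | is_largest [set w | kernel_set V w /\ w <= u] v}.
Proof. exact/cid/(kernelP V).2. Qed.

Definition kernel_below (V : kernel) (u : X) : {v | kernel_set V v} :=
  let: exist v vP := kernel_below_ex V u in exist _ v (proj1 (proj1 vP)).

Lemma kernel_belowP (V : kernel) (u : X) :
  is_largest [set w | kernel_set V w /\ w <= u] (sval (kernel_below V u)).
Proof. by rewrite /kernel_below; case: kernel_below_ex. Qed.

Lemma kernel_below_le (V : kernel) (u : X) : sval (kernel_below V u) <= u.
Proof. by have [[]] := kernel_belowP V u. Qed.

Lemma is_largest_unique (A : set X) (m m' : X) :
  is_largest A m -> is_largest A m' -> m = m'.
Proof. by move=> [Am um] [Am' um']; apply/le_anti/andP; split; [exact: um'|exact: um]. Qed.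

Lemma sval_inj (T : Type) (Q : T -> Prop) (a b : {x | Q x}) :
  sval a = sval b -> a = b.
Proof. by case: a b => [a Qa] [b Qb] /= ?; exact: eq_exist. Qed.

Lemma kernel_below_id (V : kernel) (v : {v | kernel_set V v}) :
  kernel_below V (sval v) = v.
Proof.
have vl : is_largest [set w | kernel_set V w /\ w <= sval v] (sval v).
  by split=> [|w []//]; split=> //; exact: svalP.
exact/sval_inj/(is_largest_unique (kernel_belowP V (sval v)) vl).
Qed.

End Kernels.

Fact kernel_display : Order.disp_t.
Proof. exact: Order.Disp tt tt. Qed.

HB.instance Definition _ (d : Order.disp_t) (X : porderType d) :=
  Order.Le_isPOrder.Build kernel_display (kernel X)
    (@kernel_le_refl d X) (@kernel_le_anti d X) (@kernel_le_trans d X).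

Lemma kernel_leP (d : Order.disp_t) (X : porderType d) (V W : kernel X) :
  reflect (V `<=` W) (V <= W).
Proof. exact: asboolP. Qed.

Lemma kernel_below_comp (d : Order.disp_t) (X : porderType d)
    (V W : kernel X) (u : X) : V <= W ->
  kernel_below V (sval (kernel_below W u)) = kernel_below V u.
Proof.
move=> /kernel_leP VW.
have [[_ wu] wmax] := kernel_belowP W u.
have vl : is_largest [set w | kernel_set V w /\ w <= u]
    (sval (kernel_below V (sval (kernel_below W u)))).
  have [[Vv vw] vmax] := kernel_belowP V (sval (kernel_below W u)).
  split; first by split=> //; exact: le_trans wu.
  by move=> t [Vt tu]; apply: vmax; split=> //; apply: wmax; split=> //; exact: VW.
exact/sval_inj/(is_largest_unique vl (kernel_belowP V u)).
Qed.

Record norm_covering (dX dP : Order.disp_t) (X : porderType dX)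
    (P : porderType dP) (norm : X -> P) : Prop := NormCovering {
  nc_supported : supported X;
  nc_isotone : {homo norm : x y / x <= y} }.

Section Condensate.
Variables (dX dP : Order.disp_t) (X : porderType dX) (P : porderType dP).
Variables (norm : X -> P) (ncX : norm_covering norm).
Variables (S : signature) (A : diagram P S).

Definition condensate_ob (V : kernel X) : algebra S :=
  prod_alg (fun v : {v | kernel_set V v} => A (norm (sval v))).

Definition condensate_fun (V W : kernel X)
    (a : condensate_ob V) : condensate_ob W :=
  fun w => diag_map A (nc_isotone ncX (kernel_below_le V (sval w)))
                      (a (kernel_below V (sval w))).

Lemma condensate_fun_interp (V W : kernel X) (o : operation S)
    (x : 'I_(arity o) -> condensate_ob V) :
  @condensate_fun V W (interp o x) = interp o (@condensate_fun V W \o x).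
Proof.
apply: functional_extensionality_dep => w.
by rewrite /condensate_fun hom_interp.
Qed.

Definition condensate_map (V W : kernel X) (_ : V <= W)
    : hom (condensate_ob V) (condensate_ob W) :=
  Hom (@condensate_fun_interp V W).

Lemma diag_map_eq (V : kernel X) (a : condensate_ob V) (v v' : {v | kernel_set V v}) p
    (h : norm (sval v) <= p) (h' : norm (sval v') <= p) :
  v = v' -> diag_map A h (a v) = diag_map A h' (a v').
Proof.
by move=> e; subst v'; congr (diag_map A _ _); exact: bool_irrelevance.
Qed.

Lemma condensate_id (V : kernel X) (VV : V <= V) : condensate_map VV =1 id.
Proof.
move=> a; apply: functional_extensionality_dep => w /=.
rewrite /condensate_fun.
by rewrite (diag_map_eq a _ (lexx _) (kernel_below_id w)) diag_id.
Qed.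

Lemma condensate_comp (V W Z : kernel X) (VW : V <= W) (WZ : W <= Z)
    (VZ : V <= Z) :
  condensate_map VZ =1 condensate_map WZ \o condensate_map VW.
Proof.
move=> a; apply: functional_extensionality_dep => z /=; rewrite /condensate_fun.
set hW := nc_isotone ncX (kernel_below_le W _).
set hV := nc_isotone ncX (kernel_below_le V (sval (kernel_below W _))).
rewrite (diag_map_comp _ _ (le_trans hV hW)).
by apply: diag_map_eq; rewrite kernel_below_comp.
Qed.

Definition condensate_diagram : diagram (kernel X) S :=
  Diagram condensate_id condensate_comp.

Lemma kernel_directed : directed (kernel X).
Proof.
have sX := nc_supported ncX; split.
  by have [V kV _] := sX set0 (finite_set0 _); exact: inhabits (Kernel kV).
move=> V W; have [|Z kZ VWZ] := sX (V `|` W).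
  by rewrite finite_setU; split; [exact: (kernelP V).1|exact: (kernelP W).1].
by exists (Kernel kZ); apply/kernel_leP => t ?; apply: VWZ; [left|right].
Qed.

Definition condensate : algebra S :=
  dircolim kernel_directed condensate_diagram.

End Condensate.

Definition is_maximal (d : Order.disp_t) (P : porderType d) (p : P) : Prop :=
  forall q, p <= q -> q = p.

Section Lifters.
Variables (dX dP : Order.disp_t) (X : porderType dX) (P : porderType dP).
Variable norm : X -> P.

Definition is_ideal (u : set X) : Prop :=
  [/\ u !=set0,
      forall x y, u x -> u y -> exists z, [/\ u z, x <= z & y <= z]
    & forall x y, x <= y -> u y -> u x].

(* [ideal_norm u p] means that the norm of the ideal [u] is defined and
   equal to [p]. *)
Definition ideal_norm (u : set X) (p : P) : Prop := is_largest (norm @` u) p.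

Definition sharp_ideal : set (set X) :=
  [set u | is_ideal u /\ exists p, ideal_norm u p].

Definition nonmax_ideals (bX : set (set X)) : set (set X) :=
  [set u | bX u /\ exists2 p, ideal_norm u p & ~ is_maximal p].

(* In [lifter_free] only the values of [T] on [nonmax_ideals bX] matter. *)
Record aleph0_lifter (bX : set (set X)) : Prop := Aleph0Lifter {
  lifter_covering : norm_covering norm;
  lifter_sharp : bX `<=` sharp_ideal;
  lifter_finite : forall u, nonmax_ideals bX u ->
    finite_set [set v | bX v /\ v `<=` u];
  lifter_free : forall T : set X -> set X,
    (forall u, nonmax_ideals bX u -> finite_set (T u)) ->
    exists s : P -> set X,
      [/\ forall p, bX (s p),
          forall p q, p <= q -> s p `<=` s q,
          forall p, ideal_norm (s p) p
        & forall p q, p < q -> T (s p) `&` s q `<=` s p] }.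

End Lifters.

(* Main.v *)
(* Write C for the condensate.  A sharp ideal u of X of norm p induces a
   projection of C onto A_p, reading coordinates at the largest element of
   V `&` u for each kernel V.  Let B_u be the quotient of B by the congruence
   corresponding, under Con_c B ~ Con_c C, to the kernel of this projection;
   then Con_c B_u ~ Con_c A_p, so B_u is finite when p is not maximal.
   Being a homomorphism B_u -> B_v defined by representatives, being functorial
   and lifting Con_c f_{p,q} amount, for finite B_u of finite similarity type,
   to conditions on finitely many principal congruences of B.  The compact
   congruences of C corresponding to them all come from one kernel T(u), and
   on such congruences the projection to A_q factors through the one to A_p
   as soon as T(u) `&` v is contained in u.  The lifter provides a choice of
   ideals meeting these requirements for all p < q at once. *)
Require Import Defs.
From mathcomp Require Import all_boot all_order.
From mathcomp Require Import boolp classical_sets functions cardinality.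

Set Implicit Arguments.
Unset Strict Implicit.
Unset Printing Implicit Defensive.
Local Open Scope order_scope.
Local Open Scope classical_set_scope.
Import Order.TTheory.

(** * Finite sets and directed posets *)

Lemma finite_set_ind (T : Type) (Q : set T -> Prop) :
  Q set0 -> (forall x A, finite_set A -> Q A -> Q (x |` A)) ->
  forall A, finite_set A -> Q A.
Proof.
elim/Pchoice: T => T in Q *.
move=> Q0 QS A /finite_seqP[s ->]; elim: s => [|x s IHs].
  by rewrite set_nil.
rewrite (_ : [set` x :: s] = x |` [set` s]); first exact/QS/IHs/finite_seq.
by apply/seteqP; split=> y /=; rewrite inE; move/predU1P.
Qed.

Lemma finite_set_ordfun (T : Type) (n : nat) :
  finite_set [set: T] -> finite_set [set: 'I_n -> T].
Proof.
elim/Pchoice: T => T /finite_seqP[s sT].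
pose F (f : {ffun 'I_n -> 'I_(size s)}) (j : 'I_n) := tnth (in_tuple s) (f j).
apply: (@sub_finite_set _ _ (range F)); last exact/finite_image/finite_finset.
move=> x _.
have xs j : exists i, x j = tnth (in_tuple s) i.
  by apply/tnthP; have : [set` s] (x j) by rewrite -sT.
have [f fP] := choice xs.
by exists [ffun j => f j] => //; apply/funext => j; rewrite /F ffunE -fP.
Qed.

Lemma directed_finite (d : Order.disp_t) (I : porderType d) (T : Type)
    (Q : T -> I -> Prop) (F : set T) :
  directed I -> (forall t i j, i <= j -> Q t i -> Q t j) ->
  finite_set F -> (forall t, F t -> exists i, Q t i) ->
  exists i, forall t, F t -> Q t i.
Proof.
move=> [[i0] dir] Qmono fF.
elim/finite_set_ind: fF => [_|t {}F _ IHF QF]; first by exists i0.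
have [i Qi] := IHF (fun t Ft => QF t (or_intror Ft)).
have [j Qj] := QF t (or_introl erefl).
have [k ik jk] := dir i j.
by exists k => u [->|/Qi]; [exact: Qmono jk Qj | exact: Qmono ik].
Qed.

(** * Compactness of generated congruences *)

Section Congruences.
Variables (S : signature) (A : algebra S).
Implicit Types (R F : set (A * A)) (z : A * A) (x y : conc A).

Lemma cg_mono R F : R `<=` F -> cg R `<=` cg F.
Proof.
by move=> RF; apply: cg_sub (cg_congruence _) (subset_trans RF (@sub_cg _ _ F)).
Qed.

(** Operations have finite arity, so the pairs obtained from finite subsets of [R] already form a
    congruence. *)
Lemma cg_finitary R z :
  cg R z -> exists F, [/\ finite_set F, F `<=` R & cg F z].
Proof.
move: z.
apply: (@cg_sub _ _ R [set z | exists F, [/\ finite_set F, F `<=` R & cg F z]]).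
  have cgc F : is_congruence (cg F) := cg_congruence F.
  split; first split.
  - by move=> a; exists set0; split=> //; have [[]] := cgc set0.
  - move=> a b [F [fF FR Fab]]; exists F; split=> //.
    by have [[_ sym _] _] := cgc F; exact: sym.
  - move=> a b c [F [fF FR Fab]] [G [fG GR Gbc]]; exists (F `|` G).
    split; [by rewrite finite_setU | by move=> t []; [exact: FR|exact: GR] |].
    have [[_ _ tr] _] := cgc (F `|` G).
    by apply: (tr _ b); [apply: cg_mono Fab => ?; left | apply: cg_mono Gbc => ?; right].
  - move=> o a b ab; have [F FP] := choice ab.
    exists (\bigcup_i F i); split.
    + by apply: bigcup_finite => [|i _]; [exact: finite_finset | case: (FP i)].
    + by move=> t [i _]; have [_ + _] := FP i; apply.
    + have [_ comp] := cgc (\bigcup_i F i); apply: comp => i.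
      by have [_ _ /cg_mono] := FP i; apply=> t ?; exists i.
by move=> z Rz; exists [set z]; split; [|move=> _ ->|exact: sub_cg].
Qed.

Lemma cg_compact R F : finite_set F -> F `<=` cg R ->
  exists G, [/\ finite_set G, G `<=` R & F `<=` cg G].
Proof.
move=> fF; elim/finite_set_ind: fF => [_|z {}F _ IHF FR]; first by exists set0; split.
have [G [fG GR FG]] := IHF (fun t Ft => FR t (or_intror Ft)).
have [H [fH HR Hz]] := cg_finitary (FR z (or_introl erefl)).
exists (G `|` H); split; [by rewrite finite_setU|by move=> t []; [exact: GR|exact: HR]|].
move=> t [->|/FG]; first by apply: cg_mono Hz => ?; right.
by apply: cg_mono => ?; left.
Qed.

Definition principal z : conc A :=
  Conc (ex_intro2 _ _ [set z] (finite_set1 z) erefl).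

Lemma principal_leP z x : (principal z <= x) <-> conc_rel x z.
Proof.
split=> [/conc_leP|xz]; first by apply; exact: sub_cg.
by apply/conc_leP; apply: cg_sub; [exact: conc_congruence | move=> _ ->].
Qed.

(** A congruence is the join of the compact ones below it; if these are finitely many, their finite
    generating sets together generate it, so it is itself compact. *)
Lemma finite_congruences :
  finite_set [set: conc A] -> finite_set (@is_congruence S A).
Proof.
move=> fA; apply: sub_finite_set (finite_image (@conc_rel S A) fA) => R cR.
pose gen x := projT1 (cid2 (conc_fingen x)).
have genP x : finite_set (gen x) /\ conc_rel x = cg (gen x).
  by rewrite /gen; case: cid2.
pose F := \bigcup_(x in [set x : conc A | x `<=` R]) gen x.
have fF : finite_set F.
  by apply: bigcup_finite => [|x _]; [exact: sub_finite_set fA | case: (genP x)].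
exists (Conc (ex_intro2 _ _ F fF erefl)) => //=; apply/seteqP; split.
  apply: cg_sub => // z [x /= xR gz]; apply: xR.
  by rewrite (genP x).2; exact: sub_cg.
move=> z Rz.
have zR : principal z `<=` R by apply: cg_sub => // _ ->.
apply: (@cg_mono (gen (principal z))); first by move=> t ?; exists (principal z).
by rewrite -(genP _).2; exact: sub_cg.
Qed.

End Congruences.

(** * Semilattice homomorphisms defined on Con_c *)

Lemma semilattice_hom_mono (L M : semilattice) (h : L -> M) :
  semilattice_hom h -> {homo h : x y / x <= y}.
Proof. by move=> [hU _] x y /join_idPl xy; apply/join_idPl; rewrite -hU xy. Qed.

Lemma semilattice_hom_comp (L M N : semilattice) (h : L -> M) (k : M -> N) :
  semilattice_hom h -> semilattice_hom k -> semilattice_hom (k \o h).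
Proof.
move=> [hU h0] [kU k0]; split=> [x y|] /=; last by rewrite h0 k0.
by rewrite hU kU.
Qed.

Section ConcHoms.
Variables (S : signature) (A : algebra S) (M : semilattice) (h : conc A -> M).
Hypothesis hhom : semilattice_hom h.

(* Every compact congruence is a finite join of principal ones. *)
Lemma conc_hom_le (R : set (A * A)) (x : conc A) (m : M) :
  x `<=` cg R -> (forall z, R z -> h (principal z) <= m) -> h x <= m.
Proof.
move=> xR Rm; have [F fF xF] := conc_fingen x.
have [|G [fG GR FG]] := @cg_compact _ _ R F fF.
  by apply: subset_trans xR; rewrite xF; exact: sub_cg.
have {FG} : x `<=` cg G by rewrite xF; apply: cg_sub => //; exact: cg_congruence.
have {xR F fF xF Rm R GR} : forall z, G z -> h (principal z) <= m.
  by move=> z /GR; exact: Rm.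
elim/finite_set_ind: fG x => [x _ x0|z {}G fG IHG x Gm xG].
  suff -> : x = \bot by rewrite hhom.2 le0x.
  by apply/le_anti; rewrite le0x andbT; exact/conc_leP.
pose y := Conc (ex_intro2 _ _ G fG erefl).
apply: (@le_trans _ _ (h (principal z `|` y)%O)).
  apply: semilattice_hom_mono hhom _ _ _; apply/conc_leP.
  apply: subset_trans xG _; apply: cg_sub; first exact: conc_congruence.
  move=> t [->|Gt].
    by have /principal_leP := leUl (principal z) y; exact.
  by have /conc_leP := leUr y (principal z); apply; exact: sub_cg.
rewrite hhom.1 leUx Gm /=; last by left.
by apply: IHG => // t Gt; apply: Gm; right.
Qed.

(** The congruence corresponding to the ideal of those [x] in Con_c with [h x = \bot]. *)
Definition hom_kernel : set (A * A) := [set z | h (principal z) = \bot].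

Lemma hom_kernelP (x : conc A) : h x = \bot <-> x `<=` hom_kernel.
Proof.
split=> [hx z xz|xh].
  apply/le_anti; rewrite le0x andbT -hx.
  by apply: semilattice_hom_mono => //; exact/principal_leP.
apply/le_anti; rewrite le0x andbT; apply: (@conc_hom_le hom_kernel).
  exact: subset_trans xh (@sub_cg _ _ _).
by move=> z ->.
Qed.

Lemma hom_kernel_congruence : is_congruence hom_kernel.
Proof.
suff -> : hom_kernel = cg hom_kernel by exact: cg_congruence.
apply/seteqP; split=> [|z hz]; first exact: sub_cg.
apply/le_anti; rewrite le0x andbT; apply: (@conc_hom_le hom_kernel).
  by apply: cg_sub; [exact: cg_congruence | move=> _ ->].
by move=> t ->.
Qed.

End ConcHoms.

Lemma conc_hom_ext (S : signature) (A : algebra S) (M : semilattice)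
    (h k : conc A -> M) :
  semilattice_hom h -> semilattice_hom k ->
  (forall z, h (principal z) = k (principal z)) -> h =1 k.
Proof.
move=> hh hk hkE x; apply/le_anti/andP.
have xz z : conc_rel x z -> principal z <= x by move/principal_leP.
split.
  apply: (conc_hom_le hh (@sub_cg _ _ x)) => z /xz.
  by rewrite hkE; exact: semilattice_hom_mono.
apply: (conc_hom_le hk (@sub_cg _ _ x)) => z /xz.
by rewrite -hkE; exact: semilattice_hom_mono.
Qed.

(** * Con_c of a surjective homomorphism *)

Section SurjectiveHoms.
Variables (S : signature) (A B : algebra S) (f : hom A B).

Lemma conc_map_principal z :
  conc_map f (principal z) = principal (f z.1, f z.2).
Proof.
apply/conc_inj; rewrite /= cg_hom_image; congr cg.
by apply/seteqP; split=> [_ [_ -> <-]|_ ->] //; exists z.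
Qed.

Hypothesis f_surj : forall b, exists a, f a = b.

Lemma conc_map_surj (y : conc B) : exists x, conc_map f x = y.
Proof.
have [F fF yF] := conc_fingen y; have [g gP] := choice f_surj.
pose G := [set (g z.1, g z.2) | z in F].
have fG : finite_set G by exact: finite_image.
exists (Conc (ex_intro2 _ _ G fG erefl)); apply/conc_inj.
rewrite /= cg_hom_image yF; congr cg; apply/seteqP; split.
  by move=> _ [_ [[a b] Fz <-] <-] /=; rewrite !gP.
by move=> [a b] Fz; exists (g a, g b); rewrite ?gP //; exists (a, b).
Qed.

Definition ker : set (A * A) := [set z | f z.1 = f z.2].

(* As [f] is onto, the image under [f] of the congruence generated by [R] and
   [ker] is again a congruence, and it contains the image of [R]. *)
Lemma cg_preim (R : set (A * A)) (a b : A) :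
  cg (hom_image f R) (f a, f b) -> cg (R `|` ker) (a, b).
Proof.
set C := cg (R `|` ker); have [[rC sC tC] cC] : is_congruence C := cg_congruence _.
have kC u v : f u = f v -> C (u, v) by move=> uv; apply: sub_cg; right.
pose D := [set z | exists u v, [/\ f u = z.1, f v = z.2 & C (u, v)]].
suff cD : is_congruence D.
  have RD : hom_image f R `<=` D.
    by move=> _ [[u v] Ruv <-]; exists u, v; split=> //; apply: sub_cg; left.
  move=> /(cg_sub cD RD) [u [v [/= fu fv Cuv]]].
  exact: tC (kC _ _ (esym fu)) (tC _ _ _ Cuv (kC _ _ fv)).
split; first split.
- by move=> x; have [u <-] := f_surj x; exists u, u.
- by move=> x y [u [v [/= fu fv Cuv]]]; exists v, u; split=> //; exact: sC.
- move=> x y w [u [v [/= fu fv Cuv]]] [u' [v' [/= fu' fv' Cuv']]].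
  exists u, v'; split=> //; apply: (tC _ _ _ Cuv); apply: (tC _ u') Cuv'.
  by apply: kC; rewrite fv.
- move=> o x y xy.
  have [u uP] := choice xy; have [v vP] := choice uP.
  exists (interp o u), (interp o v); split; rewrite /= ?hom_interp.
  + by congr interp; apply/funext => i; have [] := vP i.
  + by congr interp; apply/funext => i; have [] := vP i.
  + by apply: cC => i; have [] := vP i.
Qed.

Lemma conc_map_bot (x : conc A) : conc_map f x = \bot <-> x `<=` ker.
Proof.
split=> [fx [a b] xab|xk].
  have : conc_rel (\bot : conc B) (f a, f b).
    by rewrite -fx; apply: sub_cg; exists (a, b).
  have dc : is_congruence [set z : B * B | z.1 = z.2].
    split; first by split=> // ? ? ? /= -> ->.
    by move=> o u v /= uv; congr interp; apply/funext.
  by move/(cg_sub dc); exact.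
apply/le_anti; rewrite le0x andbT; apply/conc_map_subP => -[a b] /xk ab.
by rewrite /= (ab : f a = f b); have [[+ _ _] _] := conc_congruence (\bot : conc B); exact.
Qed.

(** By compactness of [x], finitely many pairs of the kernel of [f] suffice, and they generate [w].
    This form mentions only joins and elements sent to [\bot], so it can be carried along
    isomorphisms of Con_c. *)
Lemma conc_map_le (x y : conc A) :
  conc_map f x <= conc_map f y <->
  exists2 w, conc_map f w = \bot & x <= (y `|` w)%O.
Proof.
have fh := conc_map_hom f.
split=> [xy|[w w0 xyw]]; last first.
  by have := semilattice_hom_mono fh xyw; rewrite fh.1 w0 joinx0.
have xyk : x `<=` cg (y `|` ker).
  move=> [a b] xab; apply: cg_preim; move/conc_leP: xy; apply.
  by apply: sub_cg; exists (a, b).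
have [F fF xF] := conc_fingen x.
have [|G [fG Gyk FG]] := @cg_compact _ _ (y `|` ker) F fF.
  by apply: subset_trans xyk; rewrite xF; exact: sub_cg.
have fGk : finite_set (G `&` ker) by exact: finite_setIl.
exists (Conc (ex_intro2 _ _ (G `&` ker) fGk erefl)).
  have kc : is_congruence ker.
    split; first by split=> // ? ? ? ; rewrite /ker /= => -> ->.
    move=> o u v uv; rewrite /ker /= !hom_interp.
    by congr interp; apply/funext.
  by apply/conc_map_bot; apply: cg_sub => // z [].
apply/conc_leP; rewrite xF; apply: cg_sub; first exact: conc_congruence.
apply: subset_trans FG _; apply: cg_sub; first exact: conc_congruence.
move=> z Gz; apply: sub_cg; have [yz|kz] := Gyk z Gz; [by left|right].
exact: sub_cg.
Qed.

End SurjectiveHoms.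

(** * Quotient algebras and transport along an isomorphism of Con_c *)

Definition quot_hom (S : signature) (A : algebra S) (R : set (A * A))
    (cR : is_congruence R) : hom A (quot_alg R) :=
  @Hom S A (quot_alg R) (quot_pi R) (quot_pi_interp cR).

Lemma quot_hom_surj (S : signature) (A : algebra S) (R : set (A * A))
    (cR : is_congruence R) (b : quot_alg R) : exists a, quot_hom cR a = b.
Proof. by exists (quot_repr b); exact: quot_reprK. Qed.

Lemma quot_hom_bot (S : signature) (A : algebra S) (R : set (A * A))
    (cR : is_congruence R) (x : conc A) :
  conc_map (quot_hom cR) x = \bot <-> x `<=` R.
Proof.
rewrite conc_map_bot; have [eR _] := cR.
by split=> xR [a b] /xR /(eq_quot_pi eR).
Qed.

(** Both maps induce the same preorder on [L], so [k] composed with a section of [h] does not depend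
    on the section. *)
Lemma semilattice_factor (L M N : semilattice) (h : L -> M) (k : L -> N) :
  semilattice_hom h -> semilattice_hom k ->
  (forall m, exists x, h x = m) -> (forall n, exists x, k x = n) ->
  (forall x y, h x <= h y <-> k x <= k y) ->
  exists2 e : M -> N, semilattice_iso e & e \o h =1 k.
Proof.
move=> [hU h0] [kU k0] hs ks hk.
have [g gP] := choice hs; have [g' g'P] := choice ks.
have hkE x y : h x = h y <-> k x = k y.
  by split=> e; apply/le_anti/andP; split; apply/hk; rewrite e.
have ekh x : k (g (h x)) = k x by apply/hkE.
exists (k \o g) => //; split.
  split=> [m n|] /=; last by rewrite -[\bot in LHS]h0 ekh.
  by rewrite -kU -[in LHS](gP m) -[in LHS](gP n) -hU ekh.
exists (h \o g') => [m|n] /=; last by rewrite ekh.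
by rewrite -[RHS]gP; apply/hkE; rewrite g'P.
Qed.

Section QuotientOfIso.
Variables (S S' : signature) (B : algebra S) (C A : algebra S').
Variables (chi : conc B -> conc C) (f : hom C A).
Hypotheses (chi_iso : semilattice_iso chi) (f_surj : forall a, exists c, f c = a).

Definition pullback_congruence : set (B * B) := hom_kernel (conc_map f \o chi).

Lemma pullback_congruenceP : is_congruence pullback_congruence.
Proof.
apply: hom_kernel_congruence.
exact: semilattice_hom_comp chi_iso.1 (conc_map_hom f).
Qed.

(** By [conc_map_le], the preorder induced by either map is determined by the elements sent to
    [\bot], and [chi] matches these. *)
Lemma conc_quot_pullback :
  exists2 e : conc (quot_alg pullback_congruence) -> conc A,
    semilattice_iso e
  & e \o conc_map (quot_hom pullback_congruenceP) =1 conc_map f \o chi.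
Proof.
have [chi_hom [psi chiK psiK]] := chi_iso.
have fchi_hom := semilattice_hom_comp chi_hom (conc_map_hom f).
have chi_le x y : chi x <= chi y -> x <= y.
  move=> /join_idPl xy; apply/join_idPl.
  by rewrite -[RHS]chiK -xy -chi_hom.1 chiK.
apply: semilattice_factor => //; first exact: conc_map_hom.
- exact/conc_map_surj/quot_hom_surj.
- move=> y; have [x <-] := conc_map_surj f_surj y.
  by exists (psi x); rewrite /= psiK.
move=> x y; rewrite /comp (conc_map_le (@quot_hom_surj _ _ _ _)) conc_map_le //.
split=> -[w w0 xyw].
  exists (chi w).
    exact: (hom_kernelP fchi_hom w).2 ((quot_hom_bot pullback_congruenceP w).1 w0).
  by rewrite -chi_hom.1; exact: semilattice_hom_mono.
exists (psi w); last by apply: chi_le; rewrite chi_hom.1 psiK.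
apply/(quot_hom_bot pullback_congruenceP)/(hom_kernelP fchi_hom).
by rewrite /= psiK.
Qed.

End QuotientOfIso.

(** * Stages supporting a compact congruence of a directed colimit *)

Section DirectedColimitSupport.
Variables (d : Order.disp_t) (I : porderType d) (S : signature).
Variables (dirI : directed I) (D : diagram I S).

Definition supported_at (x : conc (dircolim dirI D)) (i : I) : Prop :=
  exists R : set (D i * D i), conc_rel x = cg (hom_image (dc_hom dirI D i) R).

Lemma supported_at_le x i j : i <= j -> supported_at x i -> supported_at x j.
Proof.
move=> ij [R xR]; exists (hom_image (diag_map D ij) R); rewrite xR; congr cg.
apply/seteqP; split=> [_ [[a b] Rab <-]|_ [_ [[a b] Rab <-] <-]].
  exists (diag_map D ij a, diag_map D ij b); first by exists (a, b).
  by rewrite /= !dc_in_map.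
by exists (a, b) => //=; rewrite !dc_in_map.
Qed.

Lemma supported_at_ex x : exists i, supported_at x i.
Proof.
have [F fF xF] := conc_fingen x.
pose Q (z : dircolim dirI D * dircolim dirI D) i :=
  exists a b : D i, z = (dc_in a, dc_in b).
have [z i j ij [a [b ->]]|z _|i Fi] := @directed_finite _ _ _ Q F dirI _ fF.
- by exists (diag_map D ij a), (diag_map D ij b); rewrite !dc_in_map.
- case: z => y z; have [i [a ->]] := dc_in_surj y.
  have [j [b ->]] := dc_in_surj z; have [k ik jk] := dirI.2 i j.
  by exists k, (diag_map D ik a), (diag_map D jk b); rewrite !dc_in_map.
exists i, [set ab | F (dc_in ab.1, dc_in ab.2)]; rewrite xF; congr cg.
apply/seteqP; split=> [z Fz|_ [[a b] Fab <-] //].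
by have [a [b zab]] := Fi z Fz; exists (a, b); rewrite /= -?zab.
Qed.

End DirectedColimitSupport.

(** * Projections of the condensate along sharp ideals *)

Section Projections.
Variables (dX dP : Order.disp_t) (X : porderType dX) (P : porderType dP).
Variables (norm : X -> P) (ncX : norm_covering norm).
Variables (S : signature) (A : diagram P S).
Implicit Types (u v : set X) (V : kernel X) (p q : P).
Let C := condensate ncX A.
Let dcV V : hom (condensate_ob norm A V) C :=
  dc_hom (kernel_directed ncX) (condensate_diagram ncX A) V.

Lemma ideal_finite_ub u (F : set X) : is_ideal u -> finite_set F -> F `<=` u ->
  exists2 w, u w & forall t, F t -> t <= w.
Proof.
move=> [[w0 uw0] udir _] fF; elim/finite_set_ind: fF => [_|x {}F _ IHF Fu].
  by exists w0.
have [w uw Fw] := IHF (fun t Ft => Fu t (or_intror Ft)).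
have [y [uy xy wy]] := udir x w (Fu x (or_introl erefl)) uw.
by exists y => // t [->//|/Fw tw]; exact: le_trans wy.
Qed.

(** The finite intersection has an upper bound [w] in [u]; the largest element of [V] below [w] is
    the one sought. *)
Lemma kernel_ideal_largest V u : is_ideal u ->
  exists v : {v | kernel_set V v}, is_largest (V `&` u) (sval v).
Proof.
move=> iu; have fVu : finite_set (V `&` u) by apply: finite_setIl (kernelP V).1.
have [w uw Vw] := ideal_finite_ub iu fVu (@subIsetr _ _ _).
have [[Vv vw] vmax] := kernel_belowP V w; have [_ _ lower] := iu.
exists (kernel_below V w); split; first by split=> //; exact: lower vw uw.
by move=> t Vut; apply: vmax; split; [case: Vut | exact: Vw].
Qed.

Definition is_projection u p (f : hom C (A p)) : Prop :=
  forall V (v : {v | kernel_set V v}), is_largest (V `&` u) (sval v) ->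
  forall (vp : norm (sval v) <= p) (a : condensate_ob norm A V),
  f (dcV V a) = diag_map A vp (a v).

Lemma ideal_norm_le u p x : ideal_norm norm u p -> u x -> norm x <= p.
Proof. by move=> [_ ub] ux; apply: ub; exists x. Qed.

Lemma projection_ex u p : is_ideal u -> ideal_norm norm u p ->
  exists f : hom C (A p), is_projection u f.
Proof.
move=> iu up; have [top topP] := all_sig (fun V => cid (kernel_ideal_largest V iu)).
have top_le V : norm (sval (top V)) <= p.
  by apply: ideal_norm_le up _; have [[]] := topP V.
have c_interp V (o : operation S) (x : 'I_(arity o) -> condensate_ob norm A V) :
    diag_map A (top_le V) (interp o x (top V)) =
    interp o ((fun a : condensate_ob norm A V => diag_map A (top_le V) (a (top V))) \o x).
  by rewrite /= hom_interp.
pose c V : hom (condensate_diagram ncX A V) (A p) := Hom (@c_interp V).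
(* This makes the maps [c] a cocone: directly or through [W], the same coordinate of stage [V] is
   read. *)
have top_below V W : V <= W -> kernel_below V (sval (top W)) = top V.
  move=> /kernel_leP VW; apply/sval_inj.
  apply: is_largest_unique (topP V); have [_ _ lower] := iu.
  have [[Vv vw] vmax] := kernel_belowP V (sval (top W)).
  have [[_ uW] Wmax] := topP W.
  split; first by split=> //; exact: lower vw uW.
  by move=> t [Vt ut]; apply: vmax; split=> //; apply: Wmax; split=> //; exact: VW.
have [V W VW a|f [fc _]] := @dircolim_universal _ _ _ (kernel_directed ncX) _ _ c.
  rewrite /= /condensate_fun diag_map_comp.
    exact: le_trans (nc_isotone ncX (kernel_below_le _ _)) (top_le W).
  by move=> h; apply: diag_map_eq; exact: top_below.
exists f => V v vmax vp a; rewrite [LHS]fc; apply: diag_map_eq.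
exact/sval_inj/(is_largest_unique (topP V)).
Qed.

(** Some [x] in [u] has norm [p]. If a kernel contains [x], its largest element in [u] also has norm
    [p], so that stage already maps onto [A p]. *)
Lemma projection_surj u p (f : hom C (A p)) :
  is_ideal u -> ideal_norm norm u p -> is_projection u f ->
  forall b, exists c, f c = b.
Proof.
move=> iu up fP b; have [[x ux xp] _] := up.
have [V0 kV /(_ x erefl) Vx] := nc_supported ncX (finite_set1 x).
pose V := Kernel kV; have [v vmax] := kernel_ideal_largest V iu.
have vp : norm (sval v) <= p by apply: ideal_norm_le up _; have [[]] := vmax.
have pv : p <= norm (sval v).
  by rewrite -xp; apply: (nc_isotone ncX); apply: vmax.2.
(* Only the coordinate at [v] is read, where the norm equals [p]; the test avoids a cast along this
   equality. Coordinates of norm not above [p] are arbitrary. *)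
pose a : condensate_ob norm A V := fun w =>
  if pselect (p <= norm (sval w)) is left pw then diag_map A pw b
  else inhabited_witness (carrier_inhabited (A (norm (sval w)))).
exists (dcV V a); rewrite (fP V v vmax vp) /a; case: pselect => // pw.
by rewrite (diag_map_comp _ _ (lexx p)) diag_id.
Qed.

(* On elements coming from stage [V], both projections read the coordinate at
   the largest element of [V `&` v], which lies in [u]. *)
Lemma projection_supported u v p q (pq : p <= q) (f : hom C (A p))
    (g : hom C (A q)) V (x : conc C) :
  is_ideal u -> ideal_norm norm u p -> is_projection u f -> is_projection v g ->
  u `<=` v -> V `&` v `<=` u -> supported_at x V ->
  conc_map g x = conc_map (diag_map A pq) (conc_map f x).
Proof.
move=> iu up fP gP uv Vvu [R xR].
have [w wmax] := kernel_ideal_largest V iu.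
have wp : norm (sval w) <= p by apply: ideal_norm_le up _; have [[]] := wmax.
have wmaxv : is_largest (V `&` v) (sval w).
  have [[Vw uw] wub] := wmax; split; first by split=> //; exact: uv.
  by move=> t [Vt vt]; apply: wub; split=> //; exact: Vvu.
have gf a : g (dcV V a) = diag_map A pq (f (dcV V a)).
  rewrite (gP V w wmaxv (le_trans wp pq)) (fP V w wmax wp).
  by rewrite (diag_map_comp _ _ (le_trans wp pq)).
apply/conc_inj; rewrite /= xR [cg (hom_image f _)]cg_hom_image !cg_hom_image; congr cg.
apply/seteqP; split.
  move=> _ [_ [[a b] Rab <-] <-].
  exists (f (dcV V a), f (dcV V b)); last by rewrite /= -!gf.
  by exists (dcV V a, dcV V b) => //; exists (a, b).
move=> _ [_ [_ [[a b] Rab <-] <-] <-].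
by exists (dcV V a, dcV V b); [exists (a, b) | rewrite /= -!gf].
Qed.

End Projections.

(** * Quotients of [B] attached to sharp ideals *)

Section QuotientData.
Variables (dX dP : Order.disp_t) (X : porderType dX) (P : porderType dP).
Variables (norm : X -> P) (ncX : norm_covering norm).
Variables (S S' : signature) (A : diagram P S') (B : algebra S).
Variable chi : conc B -> conc (condensate ncX A).
Hypothesis chi_iso : semilattice_iso chi.

(** [R] is a parameter so that the quotient algebra can be fixed from [u] alone, the other data
    being chosen later. *)
Record quotient_data (u : set X) (p : P) (R : set (B * B)) : Type :=
  QuotientData {
    qd_cong : is_congruence R;
    qd_proj : hom (condensate ncX A) (A p);
    qd_iso : conc (quot_alg R) -> conc (A p);
    qd_projP : is_projection u qd_proj;
    qd_isoP : semilattice_iso qd_iso;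
    qd_comm : qd_iso \o conc_map (quot_hom qd_cong) =1 conc_map qd_proj \o chi }.

Lemma quotient_data_ex u p : is_ideal u -> ideal_norm norm u p ->
  exists R, inhabited (quotient_data u p R).
Proof.
move=> iu up; have [f fP] := projection_ex ncX A iu up.
have [e eiso ecomm] := conc_quot_pullback chi_iso (projection_surj iu up fP).
by exists (pullback_congruence chi f); constructor; exact: QuotientData ecomm.
Qed.

Lemma quotient_dataP u p R (D : quotient_data u p R) z :
  R z <-> conc_map (qd_proj D) (chi (principal z)) = \bot.
Proof.
have [[_ e0] e_bij] := qd_isoP D.
have e_comm : _ = conc_map (qd_proj D) (chi (principal z)) :=
  qd_comm D (principal z).
rewrite -e_comm -e0 /=; split=> [Rz|/(bij_inj e_bij)].
  congr (qd_iso D _); apply/quot_hom_bot; apply: cg_sub; first exact: qd_cong D.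
  by move=> _ ->.
by move/quot_hom_bot; apply; exact: sub_cg.
Qed.

End QuotientData.

(** * Closure of varieties under quotients *)

Lemma eval_hom (S : signature) (A B : algebra S) (f : hom A B)
    (env : nat -> A) (t : term S) : f (eval env t) = eval (f \o env) t.
Proof.
elim: t => //= o ts IHt; rewrite hom_interp; congr interp.
by apply/funext => i; exact: IHt.
Qed.

Lemma in_variety_quot (W : variety) (A : algebra (sig_of W)) (R : set (A * A)) :
  is_congruence R -> in_variety A -> in_variety (quot_alg R).
Proof.
move=> cR AW e We env.
have -> : env = quot_hom cR \o (@quot_repr _ R \o env).
  by apply/funext => n /=; rewrite quot_reprK.
by rewrite -!eval_hom AW.
Qed.

(** * Construction of the lifting *)

Theorem theorem9p6 (V W : variety)
  (W_proper : congruence_proper W) (W_finite : finite_similarity_type W)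
  (dP dX : Order.disp_t) (P : porderType dP) (X : porderType dX)
  (norm : X -> P) (bX : set (set X)) (lX : aleph0_lifter norm bX)
  (A : diagram P (sig_of V)) (A_in_V : diagram_in A)
  (A_fin : forall p : P, ~ is_maximal p -> finite_set [set: conc (A p)])
  (B : algebra (sig_of W)) (B_in_W : in_variety B)
  (B_iso : semilattice_isomorphic
             (conc B) (conc (condensate (lifter_covering lX) A))) :
  exists Bd : diagram P (sig_of W),
    is_lifting (conc_diagram A) Bd /\ forall p : P, is_quotient_of (Bd p) B.
Proof.
have [chi chi_iso] := B_iso.
set ncX := lifter_covering lX in chi chi_iso *.
pose data u p R := quotient_data chi u p R.
have /choice[R RP] : forall u : set X, exists Ru : set (B * B), forall p,
    is_ideal u -> ideal_norm norm u p -> inhabited (data u p Ru).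
  move=> u.
  (* Norms are unique, so one congruence serves every [p]; sets that are not sharp ideals get the
     default [setT]. *)
  have [[p [iu up]]|nu] := pselect (exists p, is_ideal u /\ ideal_norm norm u p).
    have [Ru DRu] := quotient_data_ex chi_iso iu up.
    by exists Ru => q _ uq; rewrite -(is_largest_unique up uq).
  by exists setT => p iu up; case: nu; exists p.
pose Q u : algebra (sig_of W) := quot_alg (R u).
pose rep u : Q u -> B := @quot_repr B (R u).
have bX_ideal u : bX u -> is_ideal u by move=> /(lifter_sharp lX) [].
have Q_fin u : nonmax_ideals norm bX u -> finite_set [set: Q u].
  move=> [bu [p up pmax]]; have [D] := RP u p (bX_ideal _ bu) up.
  (* [qd_iso] identifies Con_c of [Q u] with the finite Con_c of [A p], so congruence-properness
     applies. *)
  apply: W_proper; first exact: in_variety_quot (qd_cong D) B_in_W.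
  apply: finite_congruences; have [_ [e' eK _]] := qd_isoP D.
  apply: (@sub_finite_set (conc (Q u)) _ (range e')) => [x _|].
    by exists (qd_iso D x).
  exact/finite_image/A_fin.
(* The pairs of [L u] express, in this order, that the transition maps out of
   [Q u] are homomorphisms, that they act on congruences as in [A], and that
   those into [Q u] compose with those out of it. *)
pose L u : set (B * B) :=
  (\bigcup_o range (fun x : 'I_(arity o) -> Q u =>
     (rep u (interp o x), interp o (rep u \o x))))
  `|` range (fun xy : Q u * Q u => (rep u xy.1, rep u xy.2))
  `|` \bigcup_(w in [set w | bX w /\ w `<=` u])
        range (fun x : Q w => (rep w x, rep u (quot_pi (R u) (rep w x)))).
have L_fin u : nonmax_ideals norm bX u -> finite_set (L u).
  move=> nu; rewrite !finite_setU; split; first split.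
  (* The similarity type is finite, and each operation has finitely many argument tuples in
     [Q u]. *)
  - apply: bigcup_finite => // o _.
    exact/finite_image/finite_set_ordfun/Q_fin.
  - by apply: finite_image; rewrite -setXTT; apply: finite_setX; exact: Q_fin.
  - apply: bigcup_finite => [|w [bw wu]]; first exact: lifter_finite lX _ nu.
    apply/finite_image/Q_fin; split=> //.
    (* The norm [q] of [w] lies below [p]; if [q] were maximal, [p] would equal it. *)
    have [_ [p up pmax]] := nu.
    have [_ [q wq]] := lifter_sharp lX bw; exists q => // qmax; apply: pmax.
    have [[x wx xq] _] := wq.
    have qp : q <= p by rewrite -xq; apply: ideal_norm_le up (wu _ wx).
    by rewrite (qmax _ qp).
(* Directedness gives one kernel for all of the finite set [L u]; kernels are finite, as the lifter
   requires. *)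
have /choice[T TP] : forall u, exists U : kernel X, nonmax_ideals norm bX u ->
    forall z, L u z -> supported_at (chi (principal z)) U.
  move=> u.
  have [nu|nu] := pselect (nonmax_ideals norm bX u); last first.
    by have [U] := (kernel_directed ncX).1; exists U.
  have [z U U' UU'|z _|U UP] := @directed_finite _ _ _
    (fun z U => supported_at (chi (principal z)) U) _
    (kernel_directed ncX) _ (L_fin u nu).
  - exact: supported_at_le.
  - exact: supported_at_ex.
  - by exists U.
have [u _|s [bs s_mono s_norm s_free]] := lifter_free lX (T := T).
  exact: (kernelP (T u)).1.
have D p : data (s p) p (R (s p)).
  by apply: inhabited_witness; apply: RP => //; exact/bX_ideal/bs.
(* As [p < q], [p] is not maximal and [T (s p)] supports these congruences; [s_free] then lets the
   projection to [A q] factor through [A p] on them. *)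
have transfer p q (pq : p <= q) z : p < q -> L (s p) z ->
    conc_map (qd_proj (D q)) (chi (principal z)) =
    conc_map (diag_map A pq) (conc_map (qd_proj (D p)) (chi (principal z))).
  move=> ltpq Lz.
  apply: (@projection_supported _ _ _ _ _ _ _ _ (s p) (s q) _ _ _ _ _ (T (s p))).
  - exact/bX_ideal/bs.
  - exact: s_norm.
  - exact: qd_projP.
  - exact: qd_projP.
  - exact: s_mono.
  - exact: s_free.
  - apply: TP Lz; split; [exact: bs | exists p; [exact: s_norm|]].
    by move=> /(_ q pq) qp; rewrite qp ltxx in ltpq.
(* Inclusion is obtained only on pairs of [L (s p)]; maps defined by representatives ask for no
   more. *)
have R_mono p q z : p <= q -> L (s p) z -> R (s p) z -> R (s q) z.
  move=> pq Lz Rz; have [<- //|npq] := eqVneq p q.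
  have ltpq : p < q by rewrite lt_neqAle npq.
  apply/(quotient_dataP (D q)); rewrite (transfer _ _ pq) //.
  rewrite ((quotient_dataP (D p) z).1 Rz).
  exact: (conc_map_hom _).2.
have cR p : is_congruence (R (s p)) := qd_cong (D p).
have eR p : equivalence (R (s p)) := (cR p).1.
pose g p q (x : Q (s p)) : Q (s q) := quot_pi (R (s q)) (rep (s p) x).
have g_interp p q (pq : p <= q) (o : operation (sig_of W))
    (x : 'I_(arity o) -> Q (s p)) : g p q (interp o x) = interp o (g p q \o x).
  rewrite -[RHS](quot_pi_interp (cR q)); apply/(eq_quot_pi (eR q)).
  apply: R_mono pq _ _; first by left; left; exists o => //; exists x.
  apply/(eq_quot_pi (eR p)); exact: quot_reprK.
have g_id p (pp : p <= p) : g p p =1 id by move=> x; exact: quot_reprK.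
have g_comp p q r (pq : p <= q) (qr : q <= r) (pr : p <= r) :
    g p r =1 g q r \o g p q.
  (* The pair, formed by the representatives of [x] and of [g p q x], belongs to the third part of
     [L (s q)]. *)
  move=> x; apply/(eq_quot_pi (eR r)); apply: (R_mono q) => //.
    by right; exists (s p); [split; [exact: bs|exact: s_mono] | exists x].
  exact: quot_repr_pi.
pose Bd : diagram P (sig_of W) :=
  @Diagram _ P _ (fun p => Q (s p)) (fun p q pq => Hom (g_interp p q pq))
    g_id g_comp.
exists Bd; split=> [|p]; last first.
  exists (R (s p)) => //.
  have idP (o : operation (sig_of W)) (x : 'I_(arity o) -> Q (s p)) :
    id (interp o x) = interp o (id \o x) by [].
  by exists (Hom idP); exists id.
split; first by move=> p; exact: in_variety_quot.
exists (fun p => qd_iso (D p)) => [p|p q pq]; first exact: qd_isoP.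
have e_hom r : semilattice_hom (qd_iso (D r)) := (qd_isoP (D r)).1.
move: pq; have [<- pp x|npq pq] := eqVneq p q.
  by rewrite /= (conc_diag_id (A := Bd)) conc_diag_id.
have ltpq : p < q by rewrite lt_neqAle npq.
(* Naturality is checked on principal congruences, each the image of one of [B] generated by a pair
   in [L (s p)]. *)
apply: conc_hom_ext => [||[x y]].
- exact: semilattice_hom_comp (conc_map_hom _) (e_hom q).
- exact: semilattice_hom_comp (e_hom p) (conc_map_hom _).
pose z := (rep (s p) x, rep (s p) y).
have Lz : L (s p) z by left; right; exists (x, y).
have z_p : principal (x, y) = conc_map (quot_hom (qd_cong (D p))) (principal z).
  by rewrite conc_map_principal /= /rep !quot_reprK.
have z_q : conc_map (diag_map Bd pq) (principal (x, y)) =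
    conc_map (quot_hom (qd_cong (D q))) (principal z).
  by rewrite !conc_map_principal.
rewrite /= z_q z_p; have := qd_comm (D q) (principal z) => /= ->.
by have := qd_comm (D p) (principal z) => /= ->; exact: transfer.
Qed.
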